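(* Let $g=\{g_1,\dots,g_m\}$, $h=\{h_1,\dots,h_l\}\subset\mathbb{R}[x]$ and assume that $S(g,h)\cap\overline{B(0,L^{1/2})}\ne\emptyset$ for some $L>0$. Let $(a_t)_{t=0,1,\dots,n}\subset\mathbb{R}^n$ be such that $a_t-a_0$, $t=1,\dots,n$, are linearly independent in $\mathbb{R}^n$. Assume that the moment-SOS hierarchies associated with the following polynomial optimization problems have finite convergence: $$\xi_0:=\min\{\|x-a_0\|_2^2:\ x\in S(g\cup\{L-\|x\|_2^2\},h)\},$$ $$\xi_t:=\min\{\|x-a_t\|_2^2:\ x\in S(g,\,h\cup\{\xi_j-\|x-a_j\|_2^2:\ j=0,\dots,t-1\})\},\quad t=1,\dots,n.$$ Let $w:=\max\{u_1,\dots,u_m,w_1,\dots,w_l,1\}$. For every $k\in\mathbb{N}$ consider the following semidefinite programs, defined successively for $t=0,1,\dots,n$, in the variable $y\in\mathbb{R}^{s(2(k+w))}$: $$\begin{array}{rl}\eta_k^0:=\inf\limits_{y}&L_y(\|x-a_0\|_2^2)\\ \text{s.t.}&M_{k+w-u_j}(g_jy)\succeq0,\ j=0,\dots,m,\\ &M_{k+w-1}((L-\|x\|_2^2)y)\succeq0,\\ &M_{k+w-w_q}(h_qy)=0,\ q=1,\dots,l,\\ &y_0=1,\end{array}$$ and, for $t=1,\dots,n$, $$\begin{array}{rl}\eta_k^t:=\inf\limits_{y}&L_y(\|x-a_t\|_2^2)\\ \text{s.t.}&M_{k+w-u_j}(g_jy)\succeq0,\ j=0,\dots,m,\\ &M_{k+w-w_q}(h_qy)=0,\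 q=1,\dots,l,\\ &M_{k+w-1}((\eta_k^j-\|x-a_j\|_2^2)y)=0,\ j=0,\dots,t-1,\\ &y_0=1.\end{array}$$ Then there exists $K\in\mathbb{N}$ such that for all $k\ge K$, $\eta_k^t=\xi_t$ for $t=0,\dots,n$. Moreover, there exist $t\in\{0,\dots,n\}$ and $\tilde K\in\mathbb{N}$ such that for all $k\ge\tilde K$, an optimal solution $y$ of the semidefinite program defining $\eta_k^t$ (whose optimal value is $\eta_k^t$) satisfies the flat extension condition, i.e. $\operatorname{rank}(M_{k+w}(y))=\operatorname{rank}(M_k(y))$. In addition, $y$ has a representing $\operatorname{rank}(M_k(y))$-atomic measure $\mu$, and $\operatorname{supp}(\mu)\subset S(g,h)$.
   Context: $x=(x_1,\dots,x_n)$; $\mathbb{N}$ contains $0$. $\overline{B(0,r)}$ is the closed Euclidean ball of radius $r$ centered at $0$. For finite sets $g,h\subset\mathbb{R}[x]$, $S(g,h):=\{x\in\mathbb{R}^n: p(x)\ge0\ \forall p\in g,\ q(x)=0\ \forall q\in h\}$. $g_0:=1$, $u_j:=\lceil\deg(g_j)/2\rceil$, $w_q:=\lceil\deg(h_q)/2\rceil$. $\mathbb{N}^n_t:=\{\alpha\in\mathbb{N}^n:|\alpha|\le t\}$, $s(t):=\binom{n+t}{n}$ is its cardinality, and vectors $y\in\mathbb{R}^{s(2t)}$ are indexed as $y=(y_\alpha)_{\alpha\in\mathbb{N}^n_{2t}}$. $L_y(\sum_\alpha p_\alpha x^\alpha):=\sum_\alpha p_\alpha y_\alpha$; $M_t(y):=(y_{\alpha+\beta})_{\alpha,\beta\in\mathbb{N}^n_t}$;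 for $p=\sum_\gamma p_\gamma x^\gamma$, $M_t(py):=(\sum_\gamma p_\gamma y_{\gamma+\alpha+\beta})_{\alpha,\beta\in\mathbb{N}^n_t}$. $\succeq 0$ means positive semidefinite. Representing measure: a finite Borel measure $\mu$ on $\mathbb{R}^n$ with $y_\alpha=\int x^\alpha\,d\mu$ for all indices $\alpha$ of $y$; it is $r$-atomic if it is a positive combination of Dirac measures at $r$ distinct points. Moment-SOS hierarchy: for a problem $f^\star=\min\{f(x):x\in S(G,H)\}$ with $G=\{G_1,\dots,G_M\}$, $H=\{H_1,\dots,H_N\}$, $G_0:=1$, the order-$d$ relaxation is $\tau_d:=\inf\{L_y(f): y\in\mathbb{R}^{s(2d)},\ M_{d-\lceil\deg(G_j)/2\rceil}(G_jy)\succeq0\ (j=0,\dots,M),\ M_{d-\lceil\deg(H_t)/2\rceil}(H_ty)=0\ (t=1,\dots,N),\ y_0=1\}$, defined for $d\ge\max\{\lceil\deg(f)/2\rceil,\lceil\deg(G_j)/2\rceil,\lceil\deg(H_t)/2\rceil\}$. It has finite convergence if there exists $d_0$ such that $\tau_d=f^\star$ for all $d\ge d_0$. *)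

(* Defs.v *)
From HB Require Import structures.
From mathcomp Require Import all_boot all_order all_algebra.
From mathcomp Require Import all_classical all_reals all_analysis.
(* The notations of [mpoly] clash with those of MathComp-Analysis. *)
From mathcomp.multinomials Require Import -(notations) mpoly.

Set Implicit Arguments.
Unset Strict Implicit.
Unset Printing Implicit Defensive.

Import Order.TTheory GRing.Theory Num.Theory.
Import numFieldNormedType.Exports.

Local Open Scope classical_set_scope.
Local Open Scope ring_scope.

Notation "{ 'mpoly' R [ n ] }" := (mpoly.mpoly n R)
  (at level 0, R, n at level 2, format "{ 'mpoly'  R [ n ] }") : type_scope.

(* The exponents of degree at most [t]: [bmultinom] uses a strict bound. *)
Notation expo n t := (mpoly.bmultinom n t.+1).

Section Polynomials.
Context {R : realType} {n : nat}.
Implicit Types (x a : 'rV[R]_n) (p : {mpoly R[n]}) (g h : seq {mpoly R[n]}).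

(* The norm of the library on ['rV[R]_n] is the max norm. *)
Definition enorm x : R := Num.sqrt (\sum_(i < n) x 0 i ^+ 2).

Definition eball (r : R) : set 'rV[R]_n := [set x | enorm x <= r].

Definition peval p x : R := mpoly.meval (fun i => x 0 i) p.

Definition cst_poly (c : R) : {mpoly R[n]} := mpoly.mpolyC n c.

(* [|x - a|_2^2] as a polynomial in [x] *)
Definition sqdist a : {mpoly R[n]} :=
  \sum_(i < n) (mpoly.mpolyX R (mpoly.mnm1 i) - cst_poly (a 0 i)) ^+ 2.

(* [ceil (deg p / 2)], with the convention [deg 0 = 0] ([msize p] is
   [deg p + 1] for [p != 0], and [0] for [p = 0]). *)
Definition half_deg p : nat := uphalf (mpoly.msize p).-1.

Definition semialg g h : set 'rV[R]_n :=
  [set x | (forall p, p \in g -> 0 <= peval p x) /\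
           (forall q, q \in h -> peval q x = 0)].

(* Equal to the minimum when it exists, which is the case for the problems
   [xi_step] below by compactness of their feasible sets. *)
Definition minval p g h : R := inf [set peval p x | x in semialg g h].

End Polynomials.

Section Moments.
Context {R : realType} {n : nat}.
Implicit Types (p q f : {mpoly R[n]}) (g h : seq {mpoly R[n]}).

Definition nth_expo s (i : 'I_#|{: expo n s}|) : mpoly.multinom n :=
  enum_val i.

(* Entry of [y] at an arbitrary exponent; the value [0] outside of the index
   set is never reached in the programs below. *)
Definition entry t (y : {ffun expo n t -> R}) (m : mpoly.multinom n) : R :=
  if insub m is Some m' then y m' else 0.

Definition riesz t (y : {ffun expo n t -> R}) p : R :=
  \sum_(m <- mpoly.msupp p) mpoly.mcoeff m p * entry y m.

Definition loc_mx t (s : nat) p (y : {ffun expo n t -> R}) :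
    'M[R]_#|{: expo n s}| :=
  \matrix_(i, j) \sum_(m <- mpoly.msupp p) mpoly.mcoeff m p *
    entry y (mpoly.mnm_add m (mpoly.mnm_add (nth_expo i) (nth_expo j))).

Definition moment_mx t (s : nat) (y : {ffun expo n t -> R}) :
    'M[R]_#|{: expo n s}| :=
  \matrix_(i, j) entry y (mpoly.mnm_add (nth_expo i) (nth_expo j)).

Definition psd m (A : 'M[R]_m) : Prop :=
  A^T = A /\ forall v : 'cV[R]_m, 0 <= (v^T *m A *m v) 0 0.

Definition relax_feasible (d : nat) g h (y : {ffun expo n (2 * d) -> R}) :
    Prop :=
  [/\ forall p, p \in 1 :: g -> psd (loc_mx (d - half_deg p) p y),
      forall q, q \in h -> loc_mx (d - half_deg q) q y = 0
    & entry y mpoly.mnm0 = 1].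

(* The order-[d] moment relaxation; [+oo] when it is infeasible. *)
Definition relax_val (d : nat) f g h : \bar R :=
  ereal_inf [set (riesz y f)%:E | y in relax_feasible (d := d) g h].

Definition relax_min_order f g h : nat :=
  \max_(p <- f :: g ++ h) half_deg p.

Definition finite_convergence f g h : Prop :=
  exists2 d0, (relax_min_order f g h <= d0)%N &
    forall d, (d0 <= d)%N -> relax_val d f g h = (minval f g h)%:E.

End Moments.

Section Measures.
Context {R : realType} {n : nat}.

Definition borel_space := g_sigma_algebraType (@open 'rV[R]_n).

Implicit Type mu : {finite_measure set borel_space -> \bar R}.

Definition monomial (m : mpoly.multinom n) (x : borel_space) : R :=
  \prod_(i < n) (x : 'rV[R]_n) 0 i ^+ m i.

Definition represents t (y : {ffun expo n t -> R}) mu : Prop :=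
  forall m : expo n t,
    mu.-integrable setT (EFin \o monomial m) /\
    (\int[mu]_x (monomial m x)%:E = (y m)%:E)%E.

Definition atomic (r : nat) mu : Prop :=
  exists (c : 'I_r -> R) (x : 'I_r -> borel_space),
    [/\ forall i, 0 < c i, injective x &
      forall A : set borel_space, measurable A ->
        mu A = (\sum_(i < r) (c i)%:E * \d_(x i) A)%E].

Definition supp mu : set 'rV[R]_n :=
  [set x | forall U : set 'rV[R]_n, open U -> U x -> (0 < mu U)%E].

End Measures.

(* Course-of-values recursion: the first [t] values of the sequence whose
   term of index [j] is [step] applied to the list of the [j] previous ones. *)
Fixpoint prevs (T : Type) (step : seq T -> T) (t : nat) : seq T :=
  if t is t'.+1 then rcons (prevs step t') (step (prevs step t')) else [::].

Section SphericalConstraints.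
Context {R : realType} {n : nat}.
Variables (g h : seq {mpoly R[n]}) (L : R) (a : n.+1.-tuple 'rV[R]_n).

(* [c - |x - b|_2^2] *)
Definition sphere (c : R) (b : 'rV[R]_n) : {mpoly R[n]} :=
  cst_poly c - sqdist b.

Definition xi_ineqs (t : nat) : seq {mpoly R[n]} :=
  if t is 0 then rcons g (sphere L 0) else g.

Definition xi_eqs (xs : seq R) : seq {mpoly R[n]} :=
  h ++ [seq sphere xs`_j a`_j | j <- iota 0 (size xs)].

Definition xi_step (xs : seq R) : R :=
  minval (sqdist a`_(size xs)) (xi_ineqs (size xs)) (xi_eqs xs).

Definition xi_val (t : nat) : R := xi_step (prevs xi_step t).

Definition xi_finite_convergence (t : nat) : Prop :=
  finite_convergence (sqdist a`_t) (xi_ineqs t) (xi_eqs (prevs xi_step t)).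

Definition min_order : nat := maxn (\max_(p <- g ++ h) half_deg p) 1.

(* For small [k] a previous value may be infinite ([+oo] for an infeasible
   program), in which case the next programs are declared infeasible. *)
Definition eta_feasible (k : nat) (es : seq (\bar R))
    (y : {ffun expo n (2 * (k + min_order)) -> R}) : Prop :=
  relax_feasible g h y /\
  if size es is 0 then psd (loc_mx (k + min_order - 1) (sphere L 0) y)
  else forall j, (j < size es)%N ->
    nth +oo%E es j \is a fin_num /\
    loc_mx (k + min_order - 1) (sphere (fine (nth +oo%E es j)) a`_j) y = 0.

Definition eta_step (k : nat) (es : seq (\bar R)) : \bar R :=
  ereal_inf [set (riesz y (sqdist a`_(size es)))%:E
            | y in eta_feasible (k := k) es].

Definition eta_val (k t : nat) : \bar R := eta_step k (prevs (eta_step k) t).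

Definition eta_optimal (k t : nat)
    (y : {ffun expo n (2 * (k + min_order)) -> R}) : Prop :=
  eta_feasible (prevs (eta_step k) t) y /\
  (riesz y (sqdist a`_t))%:E = eta_val k t.

End SphericalConstraints.

Arguments eta_feasible {R n} g h L a k es y.
Arguments eta_optimal {R n} g h L a k t y.

(* Main.v *)
Require Import Defs.
From HB Require Import structures.
From mathcomp Require Import all_boot all_order all_algebra.
From mathcomp Require Import all_classical all_reals all_analysis.
From mathcomp Require Import measurable_realfun ring lra zify.
From mathcomp.multinomials Require Import -(notations) mpoly ssrcomplements.

Set Implicit Arguments.
Unset Strict Implicit.
Unset Printing Implicit Defensive.

Import Order.TTheory GRing.Theory Num.Theory.
Import numFieldNormedType.Exports.

Local Open Scope classical_set_scope.
Local Open Scope ring_scope.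

(** The key is the last program, [t = n].  Compactness gives a point [c] of
    [S(g, h)] with [|c - a_j|^2 = xi_j] for every [j <= n] ([xi_attained]).  As
    soon as the previous values are exact, the program for [eta_k^t] is
    equivalent to the order-[(k + w)] moment relaxation of the problem defining
    [xi_t] ([eta_feasibleP]), so finite convergence yields the equality of the
    values by induction on [t] ([eta_prevsE]).

    Let then [y] be optimal for [t = n], put [d := k + w] and let
    [z_i := x_i - c_i] be the coordinates centred at [c].  Since
      [xi_j - |x - a_j|^2 = - sum_i z_i^2 - 2 sum_i (c_i - a_j,i) z_i],
    the functional [L_y] annihilates the right-hand side for all [j <= n]: for
    [j < n] this is a constraint of the program, and for [j = n] it is the
    optimality of [y].  Subtracting the case [j = 0] leaves [n] independent
    linear equations on the numbers [L_y(z_i)], which therefore all vanish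
    ([riesz_affine_eq0]).  The sphere around [a_0] now gives
    [sum_i L_y(z_i^2) = 0], a sum of nonnegative terms, and multiplying it by
    the square of a monomial [X^m] propagates this by induction on the degree of
    [m]: every [z_i X^m] with [|m| < d] lies in the kernel of [M_d(y)]
    ([riesz_zX_sq]).  Reaching the top degree [|m| = d - 1] uses the sphere
    constraint; the kernel of a moment matrix alone is stable under
    multiplication by the variables only for products of degree at most
    [d - 1].  So each [x_i] may be replaced by [c_i] under [L_y], and [y] is the
    vector of moments of the Dirac measure at [c] ([entry_concentrated]).  All
    its moment matrices have rank one, which is flatness, and the support is
    [{c}].

    Conversely the moments of that Dirac measure are feasible with value [xi_n],
    so an optimal solution exists. *)

Local Notation "'X_[ m ]" := (mpolyX _ m)
  (at level 8, m at level 2, format "''X_[' m ]").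
Local Notation "m +m m'" := (mnm_add m m') (at level 50).
Local Notation "p @_ m" := (mcoeff m p) (at level 3, m at level 2).

(** * The Riesz functional of a pseudo-moment vector *)

Section Riesz.
Context {R : realType} {n t : nat}.
Implicit Types (y : {ffun expo n t -> R}) (p q r : {mpoly R[n]}).
Implicit Types m : multinom n.

Lemma riesz_widen y p k : (msize p <= k)%N ->
  riesz y p = \sum_(m : bmultinom n k) p@_m * entry y m.
Proof.
move=> le_pk; rewrite /riesz (big_mksub (bmultinom n k)) ?msupp_uniq //=.
  by rewrite big_rmcond //= => m /memN_msupp_eq0 ->; rewrite mul0r.
by move=> m /msize_mdeg_lt /leq_trans; apply.
Qed.

Lemma riesz_linear y : linear_for *%R (riesz y).
Proof.
move=> c p q; pose k := maxn (msize p) (msize q).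
have le_cpq : (msize (c *: p + q) <= k)%N.
  rewrite (leq_trans (msizeD_le _ _))// geq_max leq_maxr andbT.
  by rewrite (leq_trans (msizeZ_le _ _))// leq_maxl.
rewrite !(@riesz_widen y _ k) ?leq_maxl ?leq_maxr// mulr_sumr -big_split /=.
by apply: eq_bigr => m _; rewrite mcoeffD mcoeffZ mulrDl mulrA.
Qed.

HB.instance Definition _ y :=
  GRing.isLinear.Build R {mpoly R[n]} R *%R (riesz y) (riesz_linear y).

Lemma riesz_sum y I (s : seq I) (P : pred I) (F : I -> {mpoly R[n]}) :
  riesz y (\sum_(i <- s | P i) F i) = \sum_(i <- s | P i) riesz y (F i).
Proof. exact: linear_sum. Qed.

Lemma rieszX y m : riesz y 'X_[m] = entry y m.
Proof. by rewrite /riesz msuppX big_seq1 mcoeffX eqxx mul1r. Qed.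

Lemma riesz1 y : riesz y 1 = entry y mnm0.
Proof. by rewrite -rieszX mpolyX0. Qed.

Lemma riesz_mulX y p m :
  riesz y (p * 'X_[m]) = \sum_(m' <- msupp p) p@_m' * entry y (m' +m m).
Proof.
rewrite {1}(mpolyE p) mulr_suml riesz_sum; apply: eq_bigr => m' _.
by rewrite -scalerAl linearZ /= -mpolyXD rieszX.
Qed.

Lemma loc_mxE y s p i j :
  loc_mx s p y i j = riesz y (p * 'X_[nth_expo i] * 'X_[nth_expo j]).
Proof. by rewrite mxE -mulrA -mpolyXD riesz_mulX. Qed.

Lemma nth_expo_surj s m : (mdeg m <= s)%N ->
  exists i : 'I_#|{: expo n s}|, nth_expo i = m.
Proof.
by move=> le_ms; exists (enum_rank (BMultinom (le_ms : mdeg m < s.+1)%N));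
  rewrite /nth_expo enum_rankK.
Qed.

Lemma mdeg_nth_expo s (i : 'I_#|{: expo n s}|) : (mdeg (nth_expo i) <= s)%N.
Proof. exact: (bmdeg (enum_val i)). Qed.

Lemma loc_mx_eq0 y s p m m' : loc_mx s p y = 0 ->
  (mdeg m <= s)%N -> (mdeg m' <= s)%N -> riesz y (p * 'X_[m] * 'X_[m']) = 0.
Proof.
move=> py0 /nth_expo_surj[i <-] /nth_expo_surj[j <-].
by rewrite -loc_mxE py0 mxE.
Qed.

(** The quadratic form of [M_s(y)] at the coefficient vector of [q] is
    [L_y(q^2)], which turns matrix positivity into positivity on squares. *)
Lemma psd_riesz_sq y s q : psd (loc_mx s 1 y) -> (msize q <= s.+1)%N ->
  0 <= riesz y (q * q).
Proof.
move=> [_ psdy] le_qs; have := psdy (\col_i q@_(nth_expo i)).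
suff -> : riesz y (q * q) = ((\col_i q@_(nth_expo i))^T *m loc_mx s 1 y *m
    \col_i q@_(nth_expo i)) 0 0 by [].
have qE : q = \sum_(i < #|{: expo n s}|) q@_(nth_expo i) *: 'X_[nth_expo i].
  rewrite {1}(mpolywE le_qs) (reindex (@enum_val (expo n s) (mem predT)))//.
  by exists enum_rank => ? _; rewrite ?enum_valK ?enum_rankK.
rewrite mxE {2}qE mulr_sumr riesz_sum; apply: eq_bigr => j _.
rewrite -scalerAr linearZ /= 2!mxE mulrC; congr (_ * _).
rewrite {1}qE mulr_suml riesz_sum; apply: eq_bigr => i _.
by rewrite -scalerAl linearZ /= loc_mxE mul1r 2!mxE.
Qed.

(** Cauchy-Schwarz: a null vector of the semidefinite form
    [(q, r) |-> L_y(q r)] lies in its kernel. *)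
Lemma riesz_sq0_mul y s q r : psd (loc_mx s 1 y) ->
  (msize q <= s.+1)%N -> (msize r <= s.+1)%N ->
  riesz y (q * q) = 0 -> riesz y (q * r) = 0.
Proof.
move=> psdy le_qs le_rs qq0; apply/eqP/negP => /negP qr_neq0.
pose B := riesz y (q * r); pose C := riesz y (r * r).
(* With this [c], the square of [c q + r] would have value [-1]. *)
pose c := - (C + 1) / (2 * B).
have : 0 <= riesz y ((c *: q + r) * (c *: q + r)).
  apply: (psd_riesz_sq psdy); rewrite (leq_trans (msizeD_le _ _))// geq_max.
  by rewrite (leq_trans (msizeZ_le _ _)).
have -> : (c *: q + r) * (c *: q + r) =
    (c * c) *: (q * q) + (2 * c) *: (q * r) + r * r.
  by rewrite -!mul_mpolyC !mpolyCM -[2%R]/(2%:R : R) mpolyC_nat; ring.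
rewrite !linearD /= !linearZ /= qq0 -/B -/C mulr0 add0r.
suff -> : 2 * c * B + C = -1 by rewrite leNgt ltrN10.
by rewrite /c; field.
Qed.

End Riesz.

(** * Moments of a point *)

Section PointMoments.
Context {R : realType} {n : nat}.
Implicit Types (x b : 'rV[R]_n) (p : {mpoly R[n]}) (m : multinom n).

Lemma pevalX m x : peval 'X_[m] x = monomial m x.
Proof. exact: mevalX. Qed.

Lemma monomialD m m' x : monomial (m +m m') x = monomial m x * monomial m' x.
Proof. by rewrite -!pevalX -[RHS]mevalM mpolyXD. Qed.

Lemma monomial0 x : monomial (@mnm0 n) x = 1.
Proof. by rewrite -pevalX mpolyX0; exact: meval1. Qed.

Lemma monomial1 i x : monomial (mnm1 i) x = x 0 i.
Proof. by rewrite -pevalX; exact: mevalXU. Qed.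

Lemma peval_sqdist b x : peval (sqdist b) x = \sum_i (x 0 i - b 0 i) ^+ 2.
Proof.
rewrite /peval /sqdist raddf_sum /=; apply: eq_bigr => i _.
by rewrite rmorphXn /= mevalB mevalC mevalXU.
Qed.

Lemma peval_sphere c b x : peval (sphere c b) x = c - peval (sqdist b) x.
Proof. by rewrite /peval mevalB mevalC. Qed.

Definition point_moments t x : {ffun expo n t -> R} :=
  [ffun m : expo n t => monomial m x].

Lemma entry_point_moments t x m : (mdeg m <= t)%N ->
  entry (point_moments t x) m = monomial m x.
Proof.
by move=> le_mt; rewrite /entry insubT// ffunE.
Qed.

Lemma point_moments_mul t x p m : (mdeg m + (msize p).-1 <= t)%N ->
  riesz (point_moments t x) (p * 'X_[m]) = peval p x * monomial m x.
Proof.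
move=> le_t; rewrite riesz_mulX /peval mevalE mulr_suml big_seq [RHS]big_seq.
apply: eq_bigr => m' /msize_mdeg_lt lt_m'p; rewrite -mulrA; congr (_ * _).
rewrite entry_point_moments ?monomialD// mdegD addnC.
by apply: leq_trans le_t; rewrite leq_add2l; case: (msize p) lt_m'p.
Qed.

Lemma riesz_point_moments t x p : ((msize p).-1 <= t)%N ->
  riesz (point_moments t x) p = peval p x.
Proof.
move=> le_t; rewrite -[p]mulr1 -mpolyX0 point_moments_mul ?mdeg0//.
by rewrite monomial0 mpolyX0 !mulr1.
Qed.

End PointMoments.

(** * Pseudo-moments concentrated at a point *)

Lemma mnmSP n (m : multinom n) e : mdeg m = e.+1 ->
  exists j m', m = (mnm1 j +m m') /\ mdeg m' = e.
Proof.
move=> mE; have /existsP[j mj] : [exists j, m j != 0%N].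
  apply: contra_eqT mE => /existsPn m0; rewrite mdegE big1// => j _.
  by apply/eqP/negPn/m0.
have mm' : m = mnm1 j +m mnm_sub m (mnm1 j).
  rewrite addmC submK//; apply/mnm_lepP => l.
  by rewrite mnm1E; case: eqP => [<-|]; rewrite ?lt0n.
exists j, (mnm_sub m (mnm1 j)); split=> //.
by move: mE; rewrite {1}mm' mdegD mdeg1 => -[].
Qed.

Lemma mnm_splitP n (m : multinom n) d d' : (mdeg m <= d + d')%N ->
  exists m1 m2, [/\ m = (m1 +m m2), (mdeg m1 <= d)%N & (mdeg m2 <= d')%N].
Proof.
elim: d' m => [|d' IH] m.
  by rewrite addn0 => le_md; exists m, mnm0; rewrite addm0 mdeg0.
case mE: (mdeg m) => [|e].
  by exists mnm0, m; rewrite add0m mdeg0 mE.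
have [j [m' [-> m'E]]] := mnmSP mE.
rewrite addnS ltnS -m'E => /IH[m1 [m2 [-> le1 le2]]].
exists m1, (mnm1 j +m m2); split=> //; last by rewrite mdegD mdeg1.
by rewrite !addmA [(mnm1 j +m m1)]addmC.
Qed.

Section Concentration.
Context {R : realType} {n t : nat}.
Variables (y : {ffun expo n t -> R}) (x : 'rV[R]_n).
Implicit Types (b : 'rV[R]_n) (m : multinom n) (q : {mpoly R[n]}).

Let z i : {mpoly R[n]} := 'X_[mnm1 i] - cst_poly (x 0 i).

(** Expansion of a sphere through [x] in the coordinates [z] centred at [x]:
    it has no constant term, and only its linear part depends on the centre. *)
Lemma riesz_sphere b q :
  riesz y (sphere (peval (sqdist b) x) b * q) =
  - (\sum_i riesz y (z i * z i * q)) -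
    \sum_i 2 * (x 0 i - b 0 i) * riesz y (z i * q).
Proof.
suff -> : sphere (peval (sqdist b) x) b * q =
    - (\sum_i z i * z i * q) - \sum_i (2 * (x 0 i - b 0 i)) *: (z i * q).
  rewrite linearB linearN /= !riesz_sum; congr (_ - _).
  by apply: eq_bigr => i _; rewrite linearZ.
rewrite peval_sqdist /sphere /cst_poly raddf_sum /= /sqdist mulrBl !mulr_suml.
rewrite -!sumrN -!big_split /=; apply: eq_bigr => i _.
rewrite -mul_mpolyC rmorphXn rmorphM !rmorphB /= /z /cst_poly.
by rewrite -[2%R]/(2%:R : R) mpolyC_nat; ring.
Qed.

(** Differences of the spheres eliminate [sum_i L_y(z_i^2)]: the vector
    [u := (L_y(z_i))_i] is orthogonal to every [a_j - a_0], hence to the whole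
    space they span, hence to itself. *)
Lemma riesz_affine_eq0 (a : n.+1.-tuple 'rV[R]_n) :
  free [seq b - a`_0 | b <- behead a] ->
  (forall j, (j <= n)%N -> riesz y (sphere (peval (sqdist a`_j) x) a`_j) = 0) ->
  forall i, riesz y (z i) = 0.
Proof.
move=> freea Ly0; pose u : 'rV[R]_n := \row_i riesz y (z i).
have spanu : u \in <<[seq b - a`_0 | b <- behead a]>>%VS.
  suff /span_basis-> : basis_of fullv [seq b - a`_0 | b <- behead a].
    exact: memvf.
  rewrite basisEfree freea subvf dimvf /dim /= size_map size_behead size_tuple.
  by rewrite mul1n.
have orth v : v \in [seq b - a`_0 | b <- behead a] -> \sum_i v 0 i * u 0 i = 0.
  case/mapP => b /(nthP 0)[j]; rewrite size_behead size_tuple /= => lt_jn <- ->.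
  have := Ly0 j.+1 lt_jn; have := Ly0 0%N isT.
  rewrite -[sphere _ _]mulr1 riesz_sphere => /eqP; rewrite subr_eq0 => /eqP E0.
  rewrite -[sphere _ _]mulr1 riesz_sphere E0 => /eqP.
  rewrite subr_eq0 => /eqP Ej.
  rewrite nth_behead.
  have two_neq0 : 2 != 0 :> R by rewrite pnatr_eq0.
  apply: (mulfI two_neq0); rewrite mulr0 mulr_sumr.
  move/eqP: Ej; rewrite -subr_eq0 -sumrB => /eqP Ej; rewrite -[RHS]Ej.
  by apply: eq_bigr => i _; rewrite !mxE !mulr1; ring.
suff u0 : \sum_i u 0 i * u 0 i = 0.
  move=> i; have := u0 => /psumr_eq0P => /(_ (fun i _ => sqr_ge0 (u 0 i))).
  by move=> /(_ i isT) /eqP; rewrite mulf_eq0 orbb mxE => /eqP.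
have [c uE] : exists c : 'I_(size [seq b - a`_0 | b <- behead a]) -> R,
    u = \sum_i c i *: [seq b - a`_0 | b <- behead a]`_i.
  by exists (coord (in_tuple [seq b - a`_0 | b <- behead a]) ^~ u);
    rewrite {1}(coord_span (X := in_tuple _) spanu).
rewrite {1}uE.
under eq_bigr => i _ do rewrite summxE mulr_suml.
rewrite exchange_big big1 //= => j _.
under eq_bigr => i _ do rewrite mxE -mulrA.
by rewrite -mulr_sumr orth ?mulr0// mem_nth.
Qed.

Variable d : nat.
Hypotheses (d_gt0 : (0 < d)%N) (psdy : psd (loc_mx d 1 y)).
Hypothesis (y0 : entry y mnm0 = 1).
Variable b : 'rV[R]_n.
Hypothesis sphere0 : (0 < n)%N ->
  loc_mx (d - 1) (sphere (peval (sqdist b) x) b) y = 0.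
Hypothesis z0 : forall i, riesz y (z i) = 0.

Lemma msize_zX i m : (mdeg m <= d - 1)%N -> (msize (z i * 'X_[m]) <= d.+1)%N.
Proof.
move=> le_md; have le_z2 : (msize (z i) <= 2)%N.
  rewrite (leq_trans (msizeD_le _ _))// msizeN geq_max msizeX mdeg1 /=.
  by rewrite msizeC leqW// leq_b1.
have [->|z_neq0] := eqVneq (z i) 0; first by rewrite mul0r msize0.
have X_neq0 : 'X_[m] != 0 :> {mpoly R[n]} by rewrite -msize_poly_eq0 msizeX.
rewrite msizeM// msizeX addnS /= (leq_trans (leq_add le_z2 le_md))//.
by rewrite add2n subn1 prednK.
Qed.

(** If the linear terms vanish against [X^m X^m], the sphere constraint turns
    into [sum_i L_y((z_i X^m)^2) = 0], a sum of nonnegative numbers. *)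
Lemma riesz_zX_sq_step i m : (mdeg m <= d - 1)%N ->
  (forall l, riesz y (z l * ('X_[m] * 'X_[m])) = 0) ->
  riesz y ((z i * 'X_[m]) * (z i * 'X_[m])) = 0.
Proof.
move=> le_md lin0; have n_gt0 : (0 < n)%N by case: (n) i => [[]|].
have := loc_mx_eq0 (sphere0 n_gt0) le_md le_md.
rewrite -mulrA riesz_sphere [X in _ - X]big1 => [|l _]; last first.
  by rewrite lin0 mulr0.
rewrite subr0 => /eqP; rewrite oppr_eq0.
under eq_bigr => l _ do rewrite mulrACA.
rewrite psumr_eq0 => [|l _]; last exact/(psd_riesz_sq psdy)/msize_zX.
by move=> /allP /(_ i); rewrite mem_index_enum /= => /(_ isT)/eqP.
Qed.

(** For [m = X_j m'], write [z_i X^m X^m] as [(z_i X^m') (X_j X^m)]: the first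
    factor is in the kernel of the form by induction, and the second has degree
    at most [d]. *)
Lemma riesz_zX_sq i m : (mdeg m <= d - 1)%N ->
  riesz y ((z i * 'X_[m]) * (z i * 'X_[m])) = 0.
Proof.
move eqe : (mdeg m) => e; elim: e m eqe i => [|e IH] m mE i le_ed.
  apply: riesz_zX_sq_step => [|l]; first by rewrite mE.
  have /eqP -> : m == mnm0 by rewrite -mdeg_eq0 mE.
  by rewrite mpolyX0 !mulr1 z0.
apply: riesz_zX_sq_step => [|l]; first by rewrite mE.
have [j [m' [mm' m'E]]] := mnmSP mE.
rewrite {1}mm' mpolyXD.
rewrite (_ : _ * _ = (z l * 'X_[m']) * ('X_[mnm1 j] * 'X_[m])); last by ring.
apply: (riesz_sq0_mul psdy).
- by apply: msize_zX; rewrite m'E; lia.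
- by rewrite -mpolyXD msizeX mdegD mdeg1 mE; lia.
- by apply: IH => //; lia.
Qed.

Lemma riesz_zX_mul i m q : (mdeg m <= d - 1)%N -> (msize q <= d.+1)%N ->
  riesz y (z i * 'X_[m] * q) = 0.
Proof.
move=> le_md le_qd; apply: (riesz_sq0_mul psdy) => //; first exact: msize_zX.
exact: riesz_zX_sq.
Qed.

(** Modulo the kernel of the form, [X_j = x_j]. *)
Lemma riesz_Xmul m q : (mdeg m <= d)%N -> (msize q <= d.+1)%N ->
  riesz y ('X_[m] * q) = monomial m x * riesz y q.
Proof.
move eqe : (mdeg m) => e; elim: e m eqe => [|e IH] m mE le_ed le_qd.
  have /eqP -> : m == mnm0 by rewrite -mdeg_eq0 mE.
  by rewrite mpolyX0 !mul1r monomial0 mul1r.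
have [j [m' [-> m'E]]] := mnmSP mE.
rewrite monomialD monomial1 -mulrA -(IH m')// 1?ltnW// mpolyXD -mulrA.
apply/eqP; rewrite -subr_eq0 -linearZ -linearB /= -mul_mpolyC -mulrBl mulrA.
by rewrite riesz_zX_mul// m'E -ltnS subn1 prednK.
Qed.

(** Split the exponent in two halves of degree at most [d]. *)
Lemma entry_concentrated m : (mdeg m <= 2 * d)%N -> entry y m = monomial m x.
Proof.
rewrite mul2n -addnn => /mnm_splitP[m1 [m2 [-> le1 le2]]].
rewrite -rieszX mpolyXD riesz_Xmul ?msizeX// -['X_[m2]]mulr1.
by rewrite riesz_Xmul ?msize1// riesz1 y0 mulr1 monomialD.
Qed.

End Concentration.

(** The moment matrix of a point [x] is the outer square of the vector of the
    monomials at [x]. *)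
Lemma rank_point_moments (R : realType) n t s (y : {ffun expo n t -> R}) x :
  (forall m, (mdeg m <= 2 * s)%N -> entry y m = monomial m x) ->
  \rank (moment_mx s y) = 1%N.
Proof.
move=> yx.
pose u : 'cV[R]_#|{: expo n s}| := \col_i monomial (nth_expo i) x.
have yE : moment_mx s y = u *m u^T.
  apply/matrixP => i j; rewrite !mxE big_ord1 !mxE -monomialD yx//.
  by rewrite mdegD mul2n -addnn leq_add ?mdeg_nth_expo.
apply/eqP; rewrite eqn_leq {1}yE.
rewrite (leq_trans (mxrankM_maxl _ _)) ?rank_leq_col//=.
rewrite lt0n mxrank_eq0; apply/eqP => /matrixP y0.
have [i iE] : exists i : 'I_#|{: expo n s}|, nth_expo i = mnm0.
  by apply: nth_expo_surj; rewrite mdeg0.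
have := y0 i i; rewrite !mxE iE addm0 yx ?mdeg0// monomial0.
by move/eqP; rewrite oner_eq0.
Qed.

(** * Feasibility of the moments of a point *)

Section Relaxations.
Context {R : realType} {n : nat}.
Implicit Types (x b : 'rV[R]_n) (p : {mpoly R[n]}) (g h : seq {mpoly R[n]}).

Lemma psd_rank1 s (c : R) (u : 'cV[R]_s) : 0 <= c -> psd (c *: (u *m u^T)).
Proof.
move=> c_ge0; split; first by rewrite linearZ /= trmx_mul trmxK.
move=> v; rewrite -scalemxAr -scalemxAl mulmxA.
rewrite -[_ *m u^T *m v]mulmxA mxE [X in _ * X]mxE big_ord1.
rewrite (_ : u^T *m v = (v^T *m u)^T); last by rewrite trmx_mul trmxK.
by rewrite [X in _ * (_ * X)]mxE mulr_ge0// sqr_ge0.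
Qed.

Lemma half_deg1 : half_deg (1 : {mpoly R[n]}) = 0%N.
Proof. by rewrite /half_deg msize1. Qed.

Lemma msize_sqdist b : (msize (sqdist b) <= 3)%N.
Proof.
apply: (leq_trans (msize_sum _ _ _)); apply/bigmax_leqP => i _.
set z := (X in X ^+ 2); have le_z2 : (msize z <= 2)%N.
  rewrite (leq_trans (msizeD_le _ _))// msizeN geq_max msizeX mdeg1 /=.
  by rewrite msizeC leqW// leq_b1.
have [->|z0] := eqVneq z 0; first by rewrite expr0n msize0.
by rewrite expr2 msizeM//; move: (msize z) le_z2 => [|[|[|]]].
Qed.

Lemma msize_sphere c b : (msize (sphere c b) <= 3)%N.
Proof.
rewrite (leq_trans (msizeD_le _ _))// geq_max msizeC msizeN msize_sqdist andbT.
by rewrite (leq_trans (leq_b1 _)).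
Qed.

Lemma half_deg_sphere_le1 c b : (half_deg (sphere c b) <= 1)%N.
Proof.
by rewrite /half_deg; move: (msize _) (msize_sphere c b) => [|[|[|[|]]]].
Qed.

(** In positive dimension a sphere polynomial is not constant: its values at
    the centre [b] and at [b + (1, ..., 1)] differ by [n]. *)
Lemma half_deg_sphere c b : (0 < n)%N -> half_deg (sphere c b) = 1%N.
Proof.
move=> n_gt0.
have gt1 : (1 < msize (sphere c b))%N.
  rewrite ltnNge; apply/negP => /msize1_polyC sphereE.
  have : peval (sphere c b) b = peval (sphere c b) (b + const_mx 1).
    by rewrite sphereE /peval !mevalC.
  rewrite !peval_sphere !peval_sqdist => /addrI/oppr_inj/eqP.
  rewrite big1 => [|i _]; last by rewrite subrr expr0n.
  rewrite eq_sym psumr_eq0 => [/allP/(_ (Ordinal n_gt0))|i _]; last first.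
    exact: sqr_ge0.
  rewrite mem_index_enum /= !mxE addrAC subrr add0r expr1n oner_eq0.
  by move=> /(_ isT).
by rewrite /half_deg; move: (msize _) (msize_sphere c b) gt1 => [|[|[|[|]]]].
Qed.

Lemma point_moments_loc_mx d s p x : (2 * s + (msize p).-1 <= d)%N ->
  let u : 'cV[R]_#|{: expo n s}| := \col_i monomial (nth_expo i) x in
  loc_mx s p (point_moments d x) = peval p x *: (u *m u^T).
Proof.
move=> le_d u; apply/matrixP => i j; rewrite loc_mxE -mulrA -mpolyXD.
rewrite point_moments_mul; last first.
  rewrite (leq_trans _ le_d)// leq_add2r mdegD mul2n -addnn.
  by rewrite leq_add ?mdeg_nth_expo.
by rewrite !mxE big_ord1 !mxE monomialD.
Qed.

Lemma point_moments_feasible d g h x :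
  (forall p, p \in g ++ h -> (half_deg p <= d)%N) -> semialg g h x ->
  relax_feasible g h (point_moments (2 * d) x).
Proof.
move=> le_d [gx hx].
have loc_order p : (half_deg p <= d)%N ->
    (2 * (d - half_deg p) + (msize p).-1 <= 2 * d)%N.
  by rewrite /half_deg uphalf_half; have := odd_double_half (msize p).-1; lia.
split.
- move=> p; rewrite inE => /orP[/eqP->|pg]; rewrite point_moments_loc_mx.
  + by apply: psd_rank1; rewrite /peval meval1 ler01.
  + by apply: loc_order; rewrite half_deg1.
  + by apply: psd_rank1; exact: gx.
  + by apply/loc_order/le_d; rewrite mem_cat pg.
- move=> q qh; rewrite point_moments_loc_mx ?hx ?scale0r//.
  by apply/loc_order/le_d; rewrite mem_cat qh orbT.
- by rewrite entry_point_moments ?mdeg0// monomial0.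
Qed.

End Relaxations.

(** In dimension [0] a sphere polynomial is a constant, so its half degree is
    [0] instead of [1]; positivity then holds at any order, since the only
    moment is the total mass. *)
Lemma psd_loc_mx_cst (R : realType) n d s (c : R) (y : {ffun expo n d -> R}) :
  n = 0%N -> 0 <= c -> entry y mnm0 = 1 -> psd (loc_mx s (sphere c 0) y).
Proof.
move=> n0; case: _ / (esym n0) in y *; move=> c_ge0 y0.
have -> : loc_mx s (sphere c 0) y =
    c *: (const_mx 1 *m (const_mx 1 : 'cV_ _)^T).
  apply/matrixP => i j; rewrite loc_mxE.
  have m0 (m : multinom 0) : m = mnm0 by apply/mnmP => -[].
  rewrite [nth_expo i]m0 [nth_expo j]m0 mpolyX0 !mulr1.
  rewrite /sphere /sqdist big_ord0 subr0 -[cst_poly c]mulr1.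
  by rewrite mul_mpolyC linearZ /= riesz1 y0 !mxE big_ord1 !mxE mulr1.
exact: psd_rank1.
Qed.

(** * Compactness and attained minima *)

Section MinimumAttained.
Context {R : realType} {n : nat}.
Implicit Types (g h : seq {mpoly R[n]}) (p : {mpoly R[n]}) (b : 'rV[R]_n).

Lemma continuous_peval p : continuous (peval p).
Proof.
rewrite (_ : peval p = fun x => \sum_(m <- msupp p) p @_m * monomial m x)//.
move=> x; apply: continuous_big => [|m _]; first exact: add_continuous.
move=> {}x; apply: continuousM; first exact: cst_continuous.
apply: continuous_big => [|i _]; first exact: mul_continuous.
move=> {}x; apply: (@continuous_comp _ _ _ (fun v : 'rV[R]_n => v 0 i)
  (fun r => r ^+ m i)); first exact: coord_continuous.
exact: exprn_continuous.
Qed.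

Lemma closed_semialg g h : closed (semialg g h).
Proof.
rewrite (_ : semialg g h =
    (\bigcap_(p in [set p | p \in g]) (peval p @^-1` [set u | 0 <= u])) `&`
    (\bigcap_(q in [set q | q \in h]) (peval q @^-1` [set u | u = 0])))//.
apply: closedI; apply: closed_bigI => p _; apply: preimage_closed.
- by move=> x _; exact: continuous_peval.
- exact: closed_ge.
- by move=> x _; exact: continuous_peval.
- exact: closed_eq.
Qed.

Lemma compact_sqdist_le (A : set 'rV[R]_n) (b : 'rV[R]_n) (c : R) :
  closed A -> (forall x, A x -> peval (sqdist b) x <= c) -> compact A.
Proof.
move=> clA Ac.
(* A coordinate [u] of [x - b] has [u^2 <= c], and [|u| <= u^2 + 1]. *)
have box := @rV_compact R n _
  (fun i => @segment_compact R (b 0 i - (c + 1)) (b 0 i + (c + 1))).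
apply: (subclosed_compact clA box) => x /Ac.
rewrite peval_sqdist => le_c i /=; rewrite in_itv /=.
have : (x 0 i - b 0 i) ^+ 2 <= c.
  apply: le_trans le_c; rewrite (bigD1 i)//= lerDl sumr_ge0// => k _.
  exact: sqr_ge0.
set u := x 0 i - b 0 i => le_uc.
have -> : x 0 i = b 0 i + u by rewrite /u; ring.
rewrite !lerD2l; have := sqr_ge0 (u - 1); have := sqr_ge0 (u + 1).
by move=> ? ?; apply/andP; split; nra.
Qed.

Lemma minval_attained g h b b' (c : R) : semialg g h !=set0 ->
  (forall x, semialg g h x -> peval (sqdist b) x <= c) ->
  exists2 x, semialg g h x & peval (sqdist b') x = minval (sqdist b') g h.
Proof.
move=> gh0 le_c; have cgh := compact_sqdist_le (@closed_semialg g h) le_c.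
have [x xgh minx] := compact_EVT_min gh0 cgh
  (@continuous_subspaceT _ _ _ _ (@continuous_peval (sqdist b'))).
exists x; first by rewrite inE in xgh.
apply/eqP; rewrite eq_le; apply/andP; split.
  apply: lb_le_inf.
    by exists (peval (sqdist b') x), x => //; rewrite inE in xgh.
  by move=> _ [v vgh <-]; apply: minx; rewrite inE.
apply: ge_inf; last by exists x => //; rewrite inE in xgh.
by exists (peval (sqdist b') x) => _ [v vgh <-]; apply: minx; rewrite inE.
Qed.

End MinimumAttained.

(** * The Dirac measure as a representing measure *)

Section DiracRepresents.
Context {R : realType} {n : nat}.
Implicit Type x : @borel_space R n.

Lemma measurable_monomial (m : multinom n) :
  measurable_fun setT (monomial m : @borel_space R n -> R).
Proof.
apply: (measurability _ (RGenOpens.measurableE R)) => _ [_ [a [b ->] <-]].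
rewrite setTI; apply: sub_sigma_algebra.
have /continuousP : continuous (monomial m : 'rV[R]_n -> R).
  by rewrite -(funext (pevalX m)); exact: continuous_peval.
by apply; exact: interval_open.
Qed.

Lemma dirac_represents t (y : {ffun expo n t -> R}) x :
  (forall m, (mdeg m <= t)%N -> entry y m = monomial m x) ->
  represents y (dirac x : {finite_measure set borel_space -> \bar R}).
Proof.
move=> yx m.
have mm : measurable_fun setT (EFin \o (monomial m : @borel_space R n -> R)).
  by apply/measurable_EFinP; exact: measurable_monomial.
split.
  apply/integrableP; split=> //.
  rewrite integral_dirac//; last exact: measurableT_comp mm.
  by rewrite diracT mul1e ltry.
rewrite integral_dirac//= diracT mul1e -yx; last exact: (bmdeg m).
by rewrite /entry insubT ?(bmdeg m)//= => lt; congr (y _)%:E; exact: val_inj.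
Qed.

Lemma dirac_atomic x :
  atomic 1 (dirac x : {finite_measure set borel_space -> \bar R}).
Proof.
exists (fun=> 1), (fun=> x); split=> // [i j _|A mA]; first by rewrite !ord1.
by rewrite big_ord1 mul1e.
Qed.

Lemma supp_dirac x :
  supp (dirac x : {finite_measure set borel_space -> \bar R}) `<=` [set x].
Proof.
move=> v suppv; apply: contrapT => vx.
suff : (0 < \d_x (~` [set (x : 'rV[R]_n)]) :> \bar R)%E.
  by rewrite diracE memNset ?ltxx//; apply.
apply: suppv => //; rewrite openC.
exact/accessible_closed_set1/hausdorff_accessible/norm_hausdorff.
Qed.

End DiracRepresents.

(** * The successive minimisation problems and their relaxations *)

Section Hierarchies.
Context {R : realType} {n : nat}.
Variables (g h : seq {mpoly R[n]}) (L : R) (a : n.+1.-tuple 'rV[R]_n).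

Lemma size_prevs T (step : seq T -> T) t : size (prevs step t) = t.
Proof. by elim: t => //= t IH; rewrite size_rcons IH. Qed.

Lemma nth_prevs T (step : seq T -> T) x0 t j : (j < t)%N ->
  nth x0 (prevs step t) j = step (prevs step j).
Proof.
elim: t => //= t IH; rewrite ltnS leq_eqVlt nth_rcons size_prevs.
by case: eqVneq => [-> _|_ /=]; rewrite ?ltnn// => lt_jt; rewrite lt_jt IH.
Qed.

Let xi := xi_val g h L a.
Let xi_prevs := prevs (xi_step g h L a).

Lemma xi_prevs_nth t j : (j < t)%N -> (xi_prevs t)`_j = xi j.
Proof. exact: nth_prevs. Qed.

Lemma xi_valE t :
  xi t = minval (sqdist a`_t) (xi_ineqs g L t) (xi_eqs h a (xi_prevs t)).
Proof. by rewrite /xi /xi_val /xi_step size_prevs. Qed.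

Lemma mem_xi_eqs t q : q \in xi_eqs h a (xi_prevs t) <->
  q \in h \/ exists2 j, (j < t)%N & q = sphere (xi j) a`_j.
Proof.
rewrite /xi_eqs mem_cat size_prevs; split=> [/orP[->|/mapP[j]]|]; first by left.
  rewrite mem_iota /= add0n => lt_jt ->; right; exists j => //.
  by rewrite -(xi_prevs_nth lt_jt).
case=> [->//|[j lt_jt ->]]; apply/orP; right; apply/mapP; exists j.
  by rewrite mem_iota.
by rewrite xi_prevs_nth.
Qed.

Lemma xi_semialgP t x : (0 < t)%N ->
  semialg (xi_ineqs g L t) (xi_eqs h a (xi_prevs t)) x <->
  semialg g h x /\ forall j, (j < t)%N -> peval (sqdist a`_j) x = xi j.
Proof.
case: t => // t _; split=> [[gx hx]|[[gx hx] ax]].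
  split; first by split=> // q qh; apply/hx/mem_xi_eqs; left.
  move=> j lt_jt; have /hx : sphere (xi j) a`_j \in xi_eqs h a (xi_prevs t.+1).
    by apply/mem_xi_eqs; right; exists j.
  by rewrite peval_sphere => /eqP; rewrite subr_eq0 => /eqP.
split=> // q /mem_xi_eqs[/hx//|[j lt_jt ->]].
by rewrite peval_sphere ax// subrr.
Qed.

Lemma xi_semialg0P x :
  semialg (xi_ineqs g L 0) (xi_eqs h a (xi_prevs 0)) x <->
  semialg g h x /\ peval (sqdist 0) x <= L.
Proof.
rewrite /xi_eqs /= cats0; split=> [[gx hx]|[[gx hx] Lx]].
  split; first by split=> // p pg; apply: gx; rewrite mem_rcons inE pg orbT.
  by rewrite -subr_ge0 -peval_sphere gx// mem_rcons inE eqxx.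
split=> // p; rewrite mem_rcons inE => /orP[/eqP->|/gx//].
by rewrite peval_sphere subr_ge0.
Qed.

Hypothesis L_gt0 : 0 < L.
Hypothesis S_meets_ball : semialg g h `&` eball (Num.sqrt L) !=set0.

Lemma xi_semialg_sub t x :
  semialg (xi_ineqs g L t) (xi_eqs h a (xi_prevs t)) x ->
  semialg g h x /\ forall j, (j < t)%N -> peval (sqdist a`_j) x = xi j.
Proof.
case: t => [/xi_semialg0P[xgh _]|t]; first by split.
by move=> /(xi_semialgP _ (ltn0Sn t)).
Qed.

(** A minimiser of one problem is feasible for the next, and each feasible set
    is bounded: by the ball for [t = 0], by the sphere around [a_0] later. *)
Lemma xi_attained t :
  exists2 x, semialg (xi_ineqs g L t) (xi_eqs h a (xi_prevs t)) x
    & peval (sqdist a`_t) x = xi t.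
Proof.
rewrite xi_valE; elim: t => [|t [x xt xE]].
  apply: (@minval_attained _ _ _ _ 0 _ L); last by move=> x /xi_semialg0P[].
  have [x [xgh xL]] := S_meets_ball; exists x; apply/xi_semialg0P; split=> //.
  have sum_ge0 : 0 <= \sum_i x 0 i ^+ 2.
    by apply: sumr_ge0 => i _; exact: sqr_ge0.
  move: xL; rewrite /eball /= /enorm (ler_sqrt _ (ltW L_gt0)) => xL.
  rewrite peval_sqdist (le_trans _ xL)// ler_sum// => i _.
  by rewrite mxE subr0.
apply: (@minval_attained _ _ _ _ a`_0 _ (xi 0%N)); last first.
  by move=> v /(xi_semialgP _ (ltn0Sn t))[_ ->].
have [xgh Ex] := xi_semialg_sub xt; exists x; apply/xi_semialgP => //.
split=> // j; rewrite ltnS leq_eqVlt => /orP[/eqP->|/Ex//].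
by rewrite xi_valE.
Qed.

Let w := min_order g h.
Let eta_prevs k := prevs (eta_step g h L a k).

Lemma half_deg_le_min_order k p : p \in g ++ h -> (half_deg p <= k + w)%N.
Proof.
move=> p_gh; rewrite (leq_trans _ (leq_addl _ _))// leq_max.
by apply/orP; left; apply: leq_bigmax_seq.
Qed.

Lemma order_gt0 k : (0 < k + w)%N.
Proof. by rewrite (leq_trans _ (leq_addl _ _))// leq_max orbT. Qed.

(** The localizing order [k + w - 1] of the spherical constraints is the one of
    the moment hierarchy, except in dimension [0]: there only the ball
    constraint occurs, as a positive constant, and it holds in both programs. *)
Lemma eta_feasibleP k t (y : {ffun expo n (2 * (k + w)) -> R}) : (t <= n)%N ->
  eta_feasible g h L a k (map EFin (xi_prevs t)) y <->
  relax_feasible (xi_ineqs g L t) (xi_eqs h a (xi_prevs t)) y.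
Proof.
move=> le_tn; rewrite /eta_feasible size_map size_prevs.
case: t le_tn => [_|t lt_tn] /=; split.
- case=> -[psdg locg y0] psdL; split=> //; last by rewrite /xi_eqs cats0.
  move=> p; rewrite inE mem_rcons inE => /orP[/eqP->|/orP[/eqP->|pg]].
  + by apply: psdg; rewrite inE eqxx.
  + have [n0|n_gt0] := posnP n; last by rewrite half_deg_sphere.
    by apply: psd_loc_mx_cst => //; exact: ltW.
  + by apply: psdg; rewrite inE pg orbT.
- case=> psdg locg y0; split.
    split=> //; last by move=> q qh; apply: locg; rewrite /xi_eqs cats0.
    move=> p; rewrite inE => /orP[/eqP->|pg]; apply: psdg.
      by rewrite inE eqxx.
    by rewrite inE mem_rcons inE pg !orbT.
  have [n0|n_gt0] := posnP n; first by apply: psd_loc_mx_cst => //; exact: ltW.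
  have := psdg (sphere L 0); rewrite half_deg_sphere//; apply.
  by rewrite inE mem_rcons inE eqxx orbT.
- case=> -[psdg locg y0] sph; split=> // q /mem_xi_eqs[/locg//|[j lt_jt ->]].
  rewrite half_deg_sphere ?(leq_trans _ lt_tn)//.
  have [_] := sph j lt_jt; rewrite (nth_map 0) ?size_prevs//=.
  by rewrite xi_prevs_nth.
- case=> psdg locg y0; split.
    by split=> // q qh; apply/locg/mem_xi_eqs; left.
  move=> j lt_jt; rewrite (nth_map 0) ?size_prevs// xi_prevs_nth//; split=> //=.
  have := locg (sphere (xi j) a`_j).
  rewrite half_deg_sphere ?(leq_trans _ lt_tn)//.
  by apply; apply/mem_xi_eqs; right; exists j.
Qed.

Hypothesis fin_conv :
  forall t, (t <= n)%N -> xi_finite_convergence g h L a t.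

Lemma uniform_convergence_order : exists K, forall k, (K <= k)%N ->
  forall t, (t <= n)%N ->
  relax_val (k + w) (sqdist a`_t) (xi_ineqs g L t) (xi_eqs h a (xi_prevs t)) =
  (xi t)%:E.
Proof.
suff : forall s, (s <= n.+1)%N -> exists K, forall k, (K <= k)%N ->
    forall t, (t < s)%N ->
    relax_val (k + w) (sqdist a`_t) (xi_ineqs g L t) (xi_eqs h a (xi_prevs t)) =
    (xi t)%:E by move=> /(_ n.+1 (leqnn _)).
elim=> [_|s IH lt_sn]; first by exists 0%N.
have [K KP] := IH (ltnW lt_sn); have [d0 _ d0P] := fin_conv lt_sn.
exists (maxn K d0) => k; rewrite geq_max => /andP[le_Kk le_d0k] t.
rewrite ltnS leq_eqVlt => /orP[/eqP->|]; last exact: KP.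
by rewrite d0P ?(leq_trans le_d0k) ?leq_addr// -xi_valE.
Qed.

Lemma eta_prevsE : exists K, forall k, (K <= k)%N -> forall t, (t <= n.+1)%N ->
  eta_prevs k t = map EFin (xi_prevs t).
Proof.
have [K KP] := uniform_convergence_order; exists K => k le_Kk.
elim=> [//|t IH lt_tn].
have stepE : eta_step g h L a k (map EFin (xi_prevs t)) = (xi t)%:E.
  rewrite -(KP k le_Kk t lt_tn) /eta_step /relax_val size_map size_prevs.
  congr ereal_inf; apply/seteqP; split=> _ [y yP <-]; exists y => //.
    by rewrite -eta_feasibleP.
  by rewrite /= eta_feasibleP.
have := IH (ltnW lt_tn); rewrite /eta_prevs /xi_prevs in stepE * => {}IH.
by rewrite /= map_rcons IH stepE.
Qed.

Lemma point_moments_eta_feasible k t x : (t <= n)%N ->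
  semialg (xi_ineqs g L t) (xi_eqs h a (xi_prevs t)) x ->
  eta_feasible g h L a k (map EFin (xi_prevs t))
    (point_moments (2 * (k + w)) x).
Proof.
move=> le_tn xt; apply/eta_feasibleP => //; apply: point_moments_feasible xt.
have sphere_le c b : (half_deg (@sphere R n c b) <= k + w)%N.
  exact: leq_trans (half_deg_sphere_le1 _ _) (order_gt0 k).
move=> p; rewrite mem_cat => /orP[|/mem_xi_eqs[ph|[j _ ->//]]]; last first.
  by apply: half_deg_le_min_order; rewrite mem_cat ph orbT.
case: t {le_tn} => [|t] /=; last first.
  by move=> pg; apply: half_deg_le_min_order; rewrite mem_cat pg.
rewrite mem_rcons inE => /orP[/eqP->//|pg].
by apply: half_deg_le_min_order; rewrite mem_cat pg.
Qed.

Hypothesis a_indep : free [seq b - a`_0 | b <- behead a].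

(** Optimality enters as the one equation [L_y(xi_n - |x - a_n|^2) = 0], which
    completes the [n] equations given by the spherical constraints. *)
Lemma optimal_is_point_moments k x (y : {ffun expo n (2 * (k + w)) -> R}) m :
  (forall j, (j < n.+1)%N -> peval (sqdist a`_j) x = xi j) ->
  eta_feasible g h L a k (map EFin (xi_prevs n)) y ->
  riesz y (sqdist a`_n) = xi n -> (mdeg m <= 2 * (k + w))%N ->
  entry y m = monomial m x.
Proof.
move=> xE /eta_feasibleP -/(_ (leqnn n))[psdg locg y0] yopt.
have psdy : psd (loc_mx (k + w) 1 y).
  by have := psdg 1; rewrite half_deg1 subn0; apply; rewrite inE eqxx.
have loc0 j : (j < n)%N ->
    loc_mx (k + w - 1) (sphere (peval (sqdist a`_j) x) a`_j) y = 0.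
  move=> lt_jn; rewrite xE; last exact: ltnW.
  have := locg (sphere (xi j) a`_j).
  rewrite half_deg_sphere ?(leq_ltn_trans _ lt_jn)//; apply.
  by apply/mem_xi_eqs; right; exists j.
apply: (entry_concentrated (order_gt0 k) psdy y0 (loc0 0%N)).
apply: (riesz_affine_eq0 a_indep) => j; rewrite leq_eqVlt => /orP[/eqP->|lt_jn].
  rewrite xE// /sphere linearB /= yopt /cst_poly -[mpolyC _ _]mulr1.
  by rewrite mul_mpolyC linearZ /= riesz1 y0 mulr1 subrr.
have := loc_mx_eq0 (loc0 j lt_jn) (m := mnm0) (m' := mnm0).
by rewrite mpolyX0 !mulr1 mdeg0; apply.
Qed.

End Hierarchies.

Theorem theorem4p3 (R : realType) (n : nat) (g h : seq {mpoly R[n]}) (L : R)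
    (a : n.+1.-tuple 'rV[R]_n)
    (L_gt0 : 0 < L)
    (S_meets_ball : semialg g h `&` eball (Num.sqrt L) !=set0)
    (a_indep : free [seq b - a`_0 | b <- behead a])
    (fin_conv : forall t, (t <= n)%N -> xi_finite_convergence g h L a t) :
  (exists K : nat, forall k, (K <= k)%N ->
     forall t, (t <= n)%N -> eta_val g h L a k t = (xi_val g h L a t)%:E) /\
  (exists2 t : nat, (t <= n)%N &
     exists K : nat, forall k, (K <= k)%N ->
       (exists y, eta_optimal g h L a k t y) /\
       forall y, eta_optimal g h L a k t y ->
         \rank (moment_mx (k + min_order g h) y) = \rank (moment_mx k y) /\
         exists mu : {finite_measure set borel_space -> \bar R},
           [/\ represents y mu,
               atomic (\rank (moment_mx k y)) mu
             & supp mu `<=` semialg g h]).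
Proof.
have [K KP] := eta_prevsE L_gt0 fin_conv.
have eta_val_xi k t : (K <= k)%N -> (t <= n)%N ->
    eta_val g h L a k t = (xi_val g h L a t)%:E.
  move=> le_Kk le_tn.
  rewrite -[LHS](nth_prevs (eta_step g h L a k) 0%E (ltnSn t)).
  by rewrite KP// (nth_map 0) ?size_prevs// nth_prevs.
split; first by exists K => k le_Kk t; exact: eta_val_xi.
have [x xn xnE] := xi_attained a L_gt0 S_meets_ball n.
have [xgh xltE] := xi_semialg_sub xn.
have xE j : (j < n.+1)%N -> peval (sqdist a`_j) x = xi_val g h L a j.
  by rewrite ltnS leq_eqVlt => /orP[/eqP->|/xltE].
exists n => //; exists K => k le_Kk; split.
  exists (point_moments _ x); split.
    by rewrite KP//; exact: point_moments_eta_feasible.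
  rewrite eta_val_xi// riesz_point_moments ?xnE//.
  rewrite (@leq_trans 2)// ?leq_pmulr ?order_gt0//.
  by move: (msize _) (msize_sqdist a`_n) => [|[|[|[|]]]].
move=> y [yfeas yopt].
have yx m : (mdeg m <= 2 * (k + min_order g h))%N -> entry y m = monomial m x.
  apply: (optimal_is_point_moments L_gt0 a_indep xE).
    by rewrite -(KP k le_Kk n (leqnSn n)).
  by apply: EFin_inj; rewrite yopt eta_val_xi.
have rank_k : \rank (moment_mx k y) = 1%N.
  apply: (@rank_point_moments _ _ _ _ _ x) => m le_mk; apply: yx.
  by rewrite (leq_trans le_mk)// leq_mul2l leq_addr orbT.
have -> : \rank (moment_mx (k + min_order g h) y) = 1%N.
  exact: rank_point_moments yx.
rewrite rank_k; split=> //.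
exists (dirac (x : borel_space)); split.
- exact: dirac_represents.
- exact: dirac_atomic.
- by move=> v /supp_dirac ->.
Qed.
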